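(* Let $q$ be a prime power, let $a_1,a_2,\ldots,a_q$ be the elements of the finite field $\mathbb{F}_q$, and let $t$ be an integer with $1\leq t\leq q-1$. For each integer $k$ with $2\leq k\leq q+1$, the code \[C=\{(f(a_1),f(a_2),\ldots,f(a_q),f_{\infty}) : f\in\mathbb{F}_q[X],\ \deg f<k\},\] where $f_\infty$ denotes the coefficient of $X^{k-1}$ in $f$, is a $(q,k,q+1)_{1,t}$-Armstrong code. Thus $f_{1,t}(q,k)\geq q+1$ for every integer $k\geq 2$.
   Context: Let $q>t\geq s\geq 1$ and $k>1$ be integers. View a $q$-ary code $C$ of length $n$ (a set of words of length $n$ over an alphabet of size $q$) as an array whose rows are the distinct codewords and whose columns are the $n$ coordinates. $C$ is called a $(q,k,n)_{s,t}$-Armstrong code if (i) for any $t+1$ (distinct) rows of $C$, there are at most $k-1$ columns such that each of them has at most $s$ distinct entries in these $t+1$ rows; and (ii) for any $k-1$ columns of $C$, there exist $t+1$ (distinct) rows such that each of the $k-1$ columns has at most $s$ distinct entries in these $t+1$ rows and, further, there exists a column of $C$ having exactly $t+1$ distinct entries in these same $t+1$ rows. $f_{s,t}(q,k)$ denotes the maximum $n$ such that a $(q,k,n)_{s,t}$-Armstrong code exists. The zero polynomial is included among the polynomials of degree less than $k$. *)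

(* Defs.v *)
From mathcomp Require Import all_boot all_algebra.

Set Implicit Arguments.
Unset Strict Implicit.
Unset Printing Implicit Defensive.

Import GRing.Theory.

Definition column_entries (n : nat) (A : finType) (R : {set n.-tuple A})
    (j : 'I_n) : {set A} :=
  [set tnth r j | r in R].

(* The standing assumptions q > t >= s >= 1 and k > 1 are not part of the
   definition; they are to be imposed where it is used.  Rows are the elements
   of the set C, so #|R| = t.+1 means t + 1 distinct codewords. *)
Definition armstrong_code (s t q k n : nat) (A : finType)
    (C : {set n.-tuple A}) : Prop :=
  [/\ #|A| = q,
      forall R : {set n.-tuple A}, R \subset C -> #|R| = t.+1 ->
        #|[set j : 'I_n | #|column_entries R j| <= s]| <= k.-1
    & forall J : {set 'I_n}, #|J| = k.-1 ->
        exists R : {set n.-tuple A},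
          [/\ R \subset C, #|R| = t.+1,
              forall j : 'I_n, j \in J -> #|column_entries R j| <= s
            & exists j : 'I_n, #|column_entries R j| = t.+1]].

Definition armstrong_length (s t q k n : nat) : Prop :=
  exists (A : finType) (C : {set n.-tuple A}), armstrong_code s t q k C.

(* The graph of the function (s, t, q, k) |-> f_{s,t}(q,k): N is the largest
   length of an Armstrong code with these parameters.  Such an N is unique
   when it exists. *)
Definition max_armstrong_length (s t q k N : nat) : Prop :=
  armstrong_length s t q k N /\
  (forall n : nat, armstrong_length s t q k n -> n <= N).

Definition extended_word (F : finFieldType) (q : nat) (a : q.-tuple F)
    (k : nat) (f : {poly F}) : q.+1.-tuple F :=
  [tuple of rcons [seq f.[x]%R | x <- a] (f`_k.-1)%R].

(* [{poly_k F}] is the type of polynomials of size at most k, that is, of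
   degree less than k, zero included. *)
Definition extended_RS_code (F : finFieldType) (q : nat) (a : q.-tuple F)
    (k : nat) : {set q.+1.-tuple F} :=
  [set extended_word a k (val f) | f : {poly_k F}].

(* Main.v *)
(* The word of a nonzero polynomial of degree less than k has at most k-1 zeros,
   since a zero at infinity lowers the degree bound; hence distinct codewords
   agree in at most k-1 columns.  Given k-1 columns, pigeonhole yields two
   polynomials agreeing on them, and the scalar multiples of their difference
   vanish on these columns and run through all of F at some other column.
   For k > q+1 the lower bound comes from the code of all words of length k.
   Lengths are bounded because a code has at most t * q^k words, while distinct
   sets of k-1 columns need distinct sets of rows. *)
Require Import Defs.
From mathcomp Require Import all_boot all_algebra all_field.
From Stdlib Require Import Classical.

Set Implicit Arguments.
Unset Strict Implicit.
Unset Printing Implicit Defensive.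

Import GRing.Theory.

(** * From Armstrong clauses to pairs and pencils of words *)

Lemma column_entries_le1P (n : nat) (A : finType) (R : {set n.-tuple A})
    (j : 'I_n) :
  reflect {in R &, forall u v, tnth u j = tnth v j} (#|column_entries R j| <= 1).
Proof.
apply: (iffP card_le1_eqP) => [eqR u v uR vR | eqR _ _ /imsetP[u uR ->] /imsetP[v vR ->]].
  by apply/esym/eqR; apply: imset_f.
exact: eqR.
Qed.

(** Since [t.+1 >= 2], a column constant on [t.+1] rows is one where two distinct rows agree, so the
    first clause becomes a pairwise condition. For the second, [t < q] leaves room for [t.+1]
    letters [c]; the words [w c] coincide on [J] and are pairwise distinct in column [i]. *)
Lemma armstrong_code1_of_pencils (t q k n : nat) (A : finType)
    (C : {set n.-tuple A}) :
  0 < t < q -> #|A| = q ->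
  {in C &, forall u v, u != v -> #|[set j | tnth u j == tnth v j]| <= k.-1} ->
  (forall J : {set 'I_n}, #|J| = k.-1 ->
     exists (w : A -> n.-tuple A) (i : 'I_n),
       [/\ forall c, w c \in C,
           forall c d, {in J, forall j, tnth (w c) j = tnth (w d) j}
         & injective (fun c => tnth (w c) i)]) ->
  armstrong_code 1 t q k C.
Proof.
move=> /andP[t_gt0 ltq] cardA agreeC pencilC; split=> // [R RC cardR | J cardJ].
  have /card_gt1P[u [v [uR vR neq]]] : 1 < #|R| by rewrite cardR.
  apply: leq_trans (agreeC u v (subsetP RC u uR) (subsetP RC v vR) neq).
  apply/subset_leq_card/subsetP=> j; rewrite !inE => /column_entries_le1P eqR.
  by rewrite (eqR u v).
have [w [i [wC wJ wi]]] := pencilC J cardJ.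
have /card_geqP[s [Us sizes _]] : t.+1 <= #|A| by rewrite cardA.
have cards : #|[set x in s]| = t.+1 by rewrite cardsE (card_uniqP Us).
exists (w @: [set x in s]); split.
- by apply/subsetP=> _ /imsetP[c _ ->].
- by rewrite card_imset // => c d eq_w; apply: wi; rewrite /= eq_w.
- move=> j jJ; apply/column_entries_le1P=> _ _ /imsetP[c _ ->] /imsetP[d _ ->].
  exact: wJ.
- exists i; rewrite /column_entries -imset_comp card_imset //.
Qed.

(** * Extended Reed-Solomon words *)

Lemma tnth_extended_word_widen (F : finFieldType) (q : nat) (a : q.-tuple F)
    (k : nat) (f : {poly F}) (i : 'I_q) :
  tnth (extended_word a k f) (widen_ord (leqnSn q) i) = f.[tnth a i]%R.
Proof.
rewrite (tnth_nth 0%R) /= nth_rcons size_map size_tuple ltn_ord.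
by rewrite (nth_map 0%R) ?size_tuple // -tnth_nth.
Qed.

Lemma tnth_extended_word_max (F : finFieldType) (q : nat) (a : q.-tuple F)
    (k : nat) (f : {poly F}) :
  tnth (extended_word a k f) ord_max = (f`_k.-1)%R.
Proof. by rewrite (tnth_nth 0%R) /= nth_rcons size_map size_tuple ltnn eqxx. Qed.

Lemma ord_max_widenP (q : nat) (j : 'I_q.+1) :
  j = ord_max \/ exists i : 'I_q, j = widen_ord (leqnSn q) i.
Proof.
case: (ltnP j q) => [ltjq | leqj]; [right; exists (Ordinal ltjq) | left];
  apply: val_inj => //=.
by apply/eqP; rewrite eqn_leq leqj -ltnS ltn_ord.
Qed.

(** Every coordinate, the one at infinity included, is linear in the polynomial. With [c] equal to 1
    this turns agreements into zeros; with varying [c] it describes the pencil. *)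
Lemma tnth_extended_wordZB (F : finFieldType) (q : nat) (a : q.-tuple F)
    (k : nat) (c : F) (f g : {poly F}) (j : 'I_q.+1) :
  (tnth (extended_word a k (c *: (f - g))) j =
   c * (tnth (extended_word a k f) j - tnth (extended_word a k g) j))%R.
Proof.
have [->|[i ->]] := ord_max_widenP j.
  by rewrite !tnth_extended_word_max coefZ coefB.
by rewrite !tnth_extended_word_widen hornerZ hornerD hornerN.
Qed.

Lemma extended_word_zeros (F : finFieldType) (q : nat) (a : q.-tuple F)
    (k : nat) (h : {poly F}) :
  uniq a -> h != 0%R -> size h <= k ->
  #|[set j | tnth (extended_word a k h) j == 0%R]| <= k.-1.
Proof.
move=> Ua h0 szh.
have -> : #|[set j | tnth (extended_word a k h) j == 0%R]|
    = count (root h) a + (h`_k.-1 == 0)%R.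
  rewrite -sum1_card big_mkcond big_ord_recr /= inE tnth_extended_word_max.
  congr (_ + _).
  rewrite -sum1_count big_tuple [RHS]big_mkcond /=; apply: eq_bigr => i _.
  by rewrite inE tnth_extended_word_widen.
have ltroots : count (root h) a < size h.
  by rewrite -size_filter max_poly_roots ?filter_all ?filter_uniq.
have [hk0 | _] := eqVneq (h`_k.-1)%R 0%R; last first.
  by rewrite addn0 -ltnS (leq_trans ltroots) // (leq_trans szh) // leqSpred.
(* If [size h] were [k], the vanishing coefficient would be the leading one. The size bound thus
   drops by one, which pays for the zero at infinity. *)
have lthk : size h < k.
  rewrite ltn_neqAle szh andbT; apply: contraNneq h0 => szhk.
  by rewrite -lead_coef_eq0 lead_coefE szhk hk0.
by rewrite addn1 -ltnS (leq_trans _ (leqSpred k)) // (leq_trans _ lthk).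
Qed.

Lemma extended_RS_codeP (F : finFieldType) (q : nat) (a : q.-tuple F)
    (k : nat) (u : q.+1.-tuple F) :
  reflect (exists2 f : {poly F}, size f <= k & u = extended_word a k f)
          (u \in extended_RS_code a k).
Proof.
apply: (iffP imsetP) => [[f _ ->] | [f szf ->]].
  by exists (val f) => //; apply: size_npoly.
by exists (NPoly szf).
Qed.

Lemma ex_polys_agreeing (F : finFieldType) (q : nat) (a : q.-tuple F)
    (k : nat) (J : {set 'I_q.+1}) :
  #|J| < k ->
  exists f g : {poly F}, [/\ f != g, size f <= k, size g <= k
    & {in J, forall j,
        tnth (extended_word a k f) j = tnth (extended_word a k g) j}].
Proof.
move=> ltJk.
pose r (f : {poly_k F}) : {ffun {j | j \in J} -> F} :=
  [ffun j => tnth (extended_word a k (val f)) (val j)].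
(* There are [#|F| ^ k] polynomials but only [#|F| ^ #|J|] restrictions to [J]. *)
have /injectivePn[f [g neq eq_r]] : ~~ injectiveb r.
  apply/injectiveP=> /leq_card; rewrite card_npoly card_ffun card_sig.
  by rewrite leq_exp2l ?finNzRing_gt1 // leqNgt ltJk.
exists (val f), (val g); split=> //; try exact: size_npoly.
move=> j jJ; have /ffunP/(_ (exist _ j jJ)) := eq_r.
by rewrite !ffunE.
Qed.

Lemma extended_RS_code_armstrong (F : finFieldType) (q t k : nat)
    (a : q.-tuple F) :
  #|F| = q -> uniq a -> 0 < t < q -> 2 <= k <= q.+1 ->
  armstrong_code 1 t q k (extended_RS_code a k).
Proof.
move=> cardF Ua htq /andP[k2 kq]; apply: armstrong_code1_of_pencils => //.
  move=> _ _ /extended_RS_codeP[f szf ->] /extended_RS_codeP[g szg ->] neq.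
  have fg0 : (f - g != 0)%R.
    by rewrite subr_eq0; apply: contraNneq neq => ->.
  have szfg : size (f - g)%R <= k.
    by rewrite (leq_trans (size_polyD _ _)) // size_polyN geq_max szf.
  apply: leq_trans (extended_word_zeros Ua fg0 szfg).
  apply/subset_leq_card/subsetP=> j; rewrite !inE -[(f - g)%R]scale1r.
  by rewrite tnth_extended_wordZB mul1r subr_eq0.
move=> J cardJ; have ltJk : #|J| < k by rewrite cardJ prednK // ltnW.
have [f [g [neq szf szg eqJ]]] := ex_polys_agreeing a ltJk.
have fg0 : (f - g != 0)%R by rewrite subr_eq0.
have szfg : size (f - g)%R <= k.
  by rewrite (leq_trans (size_polyD _ _)) // size_polyN geq_max szf.
(* At most [k.-1] of the [q.+1] columns are zeros, and [k <= q.+1]. *)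
have [i nzi] : exists i, tnth (extended_word a k (f - g)%R) i != 0%R.
  apply/existsP; rewrite -negb_forall; apply/negP=> /forallP z.
  have := extended_word_zeros Ua fg0 szfg.
  rewrite (eq_card (_ : _ =i 'I_q.+1)) => [|j]; last by rewrite !inE z.
  by rewrite card_ord leqNgt prednK ?(ltnW k2) ?kq.
exists (fun c => extended_word a k (c *: (f - g))%R), i; split.
- move=> c; apply/extended_RS_codeP; exists (c *: (f - g))%R => //.
  exact: leq_trans (size_scale_leq _ _) szfg.
- by move=> c d j jJ; rewrite !tnth_extended_wordZB eqJ // subrr !mulr0.
- move=> c d /=; rewrite !tnth_extended_wordZB.
  rewrite -[(f - g)%R]scale1r tnth_extended_wordZB mul1r in nzi.
  exact: mulIf.
Qed.

(** * The code of all words of length [k] *)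

Lemma full_code_armstrong (q t k : nat) (A : finType) :
  #|A| = q -> 0 < t < q -> 0 < k ->
  armstrong_code 1 t q k [set: k.-tuple A].
Proof.
move=> cardA htq k0; apply: armstrong_code1_of_pencils => // [u v _ _ neq | J cardJ].
  rewrite -ltnS prednK //.
  apply: (@leq_trans #|[set: 'I_k]|); last by rewrite cardsT card_ord.
  apply: proper_card.
  rewrite properT; apply: contraNneq neq => eqT; apply/eqP/eq_from_tnth => j.
  by apply/eqP; move/setP/(_ j): eqT; rewrite !inE.
have /subsetPn[i _ iJ] : ~~ ([set: 'I_k] \subset J).
  by apply/negP=> /subset_leq_card; rewrite cardsT card_ord cardJ -ltnS prednK ?ltnn.
have /card_gt0P[x _] : 0 < #|A| by rewrite cardA; case/andP: htq; case: (q).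
(* The pencil keeps a fixed letter [x] everywhere except in column [i], which lies outside [J]. *)
exists (fun c => [tuple if j == i then c else x | j < k]), i; split.
- by move=> c; rewrite inE.
- move=> c d j jJ; rewrite !tnth_mktuple; case: eqP => // eji.
  by rewrite -eji jJ in iJ.
- by move=> c d; rewrite /= !tnth_mktuple eqxx.
Qed.

(** * Boundedness of Armstrong lengths *)

(** Restrict the words to [k] fixed columns: each of the [q ^ k] fibres has at most [t] words, as
    [t.+1] words agreeing on [k] columns would violate the first clause. *)
Lemma armstrong_code_card_le (t q k n : nat) (A : finType)
    (C : {set n.-tuple A}) :
  0 < k <= n -> armstrong_code 1 t q k C -> #|C| <= t * q ^ k.
Proof.
case/andP=> k0 kn [cardA constC _].
have /card_geqP[s [Us sizes _]] : k <= #|'I_n| by rewrite card_ord.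
pose K := [set j in s]; have cardK : #|K| = k by rewrite cardsE (card_uniqP Us).
pose r (u : n.-tuple A) : {ffun {j | j \in K} -> A} :=
  [ffun j => tnth u (val j)].
rewrite -sum1_card (partition_big r xpredT) //=.
have -> : t * q ^ k = \sum_(y : {ffun {j | j \in K} -> A}) t.
  by rewrite sum_nat_const card_ffun card_sig cardA cardK mulnC.
apply: leq_sum => y _; rewrite sum1_card leqNgt; apply/negP.
move=> /card_geqP[R [UR sizeR subR]].
have RC : [set u in R] \subset C.
  by apply/subsetP=> u; rewrite inE => /subR/andP[].
have := constC _ RC; rewrite cardsE (card_uniqP UR) => /(_ sizeR).
apply/negP; rewrite -ltnNge prednK // -cardK; apply: subset_leq_card.
apply/subsetP=> j jK; rewrite inE; apply/column_entries_le1P=> u v.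
rewrite !inE => /subR/andP[_ /eqP ru] /subR/andP[_ /eqP rv].
have /ffunP/(_ (exist _ j jK)) : r u = r v by rewrite ru.
by rewrite !ffunE.
Qed.

Lemma leq_bin_self (n m : nat) : 0 < m < n -> n <= 'C(n, m).
Proof.
elim: n m => [|n IHn] [|m] //= ltmn; rewrite binS.
have [ltSmn | lenSm] := ltnP m.+1 n.
  by rewrite -addn1 leq_add ?IHn // bin_gt0 ltnW // ltnW.
have -> : n = m.+1 by apply/eqP; rewrite eqn_leq lenSm.
by rewrite binn add1n binSn.
Qed.

(* Each set J of k-1 columns is exactly the set of constant columns of some
   subset R of C, so R |-> J shows that C has many subsets. *)
Lemma armstrong_code_bin_le (t q k n : nat) (A : finType)
    (C : {set n.-tuple A}) :
  armstrong_code 1 t q k C -> 'C(n, k.-1) <= 2 ^ #|C|.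
Proof.
case=> [_ constC coverC]; rewrite -{1}(card_ord n) -card_draws -card_powerset.
pose cst (R : {set n.-tuple A}) := [set j | #|column_entries R j| <= 1].
apply: leq_trans (leq_imset_card cst _); apply/subset_leq_card/subsetP=> J.
rewrite inE => /eqP cardJ; have [R [RC cardR constJ _]] := coverC J cardJ.
apply/imsetP; exists R; rewrite ?powersetE //.
(* The first clause caps the constant columns of [R] at [k.-1], the size of [J], so inclusion
   suffices. *)
apply/eqP; rewrite eqEcard cardJ constC // andbT.
by apply/subsetP=> j /constJ; rewrite inE.
Qed.

(** For [n > k] the binomial bound applies, with [k.-1] strictly between 0 and [n]; the [maxn]
    absorbs the lengths up to [k]. *)
Lemma armstrong_length_le (t q k n : nat) :
  1 < k -> armstrong_length 1 t q k n -> n <= maxn k (2 ^ (t * q ^ k)).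
Proof.
move=> k1 [A [C armC]]; rewrite leq_max; case: leqP => //= ltkn.
have k0 : 0 < k by apply: ltnW.
apply: leq_trans (leq_bin_self (_ : 0 < k.-1 < n)) _.
  by case: (k) k1 ltkn => [|[|k']] //= _ /ltnW.
apply: leq_trans (armstrong_code_bin_le armC) _.
by rewrite leq_exp2l // (armstrong_code_card_le _ armC) // k0 ltnW.
Qed.

(** Lower the bound [b] until it is attained; excluded middle decides [P] at each value. *)
Lemma ex_max_nat (P : nat -> Prop) (m b : nat) :
  P m -> (forall n, P n -> n <= b) ->
  exists N, P N /\ (forall n, P n -> n <= N).
Proof.
move=> Pm; elim: b => [|b IHb] leb; first by exists m; split=> // n /leb; case: n.
case: (classic (P b.+1)) => [Pb | nPb]; first by exists b.+1.
apply: IHb => n Pn; move: (leb n Pn); rewrite leq_eqVlt => /orP[/eqP eqn | //].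
by rewrite eqn in Pn.
Qed.

Theorem proposition16 (q t : nat)
  (hq : exists p m : nat, [/\ prime p, 0 < m & q = p ^ m])
  (ht : 1 <= t <= q - 1) :
  (forall (F : finFieldType) (a : q.-tuple F), #|F| = q -> uniq a ->
     forall k : nat, 2 <= k <= q.+1 ->
       armstrong_code 1 t q k (extended_RS_code a k)) /\
  (forall k : nat, 2 <= k ->
     exists N : nat, max_armstrong_length 1 t q k N /\ q.+1 <= N).
Proof.
have htq : 0 < t < q.
  case/andP: ht => t0 letq; rewrite t0 /=.
  (* Subtraction is truncated: [q = 0] would force [t = 0]. *)
  by case: (q) letq t0 => [|q']; [case: (t) | rewrite subn1].
split=> [F a cardF Ua k hk | k k2]; first exact: extended_RS_code_armstrong.
have [n [lqn armn]] : exists n, q < n /\ armstrong_length 1 t q k n.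
  case: (leqP k q.+1) => [kq | /ltnW ltqk].
    have [p [m [pp m0 eqq]]] := hq.
    have [F _ cardF] := pPrimePowerField pp m0; rewrite -eqq in cardF.
    have sizeF : size (enum F) == q by rewrite -cardE cardF.
    exists q.+1; split=> //; exists F, (extended_RS_code (Tuple sizeF) k).
    by apply: extended_RS_code_armstrong; rewrite ?enum_uniq ?k2.
  exists k; split=> //; exists 'I_q, [set: k.-tuple 'I_q].
  by apply: full_code_armstrong; rewrite ?card_ord ?(ltnW k2).
have [N [armN maxN]] := ex_max_nat armn (fun _ => armstrong_length_le k2).
by exists N; do !split=> //; apply: leq_trans lqn (maxN n armn).
Qed.
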